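(* Let $N$ be a positive integer and let $m\in\mathcal{D}_N^*$ be such that $\ell(m)$ is divisible by a prime $p$. Then for every integer $h$ we have $$\prod_{j=0}^{p-1}F_{m,\,h+xj}\approx F_{mp,\;p^{\varepsilon}h},$$ where $x=\ell(m)/p$ and $\varepsilon=1+v_p(\ell(mp))-v_p(\ell(m))$.
   Context: $f\approx g$ means $f=cg$ for some constant $c\in\mathbf{C}^*$; $v_p$ is the $p$-adic valuation. Let $q=e^{2\pi i\tau}$, $\zeta_n=e^{2\pi i/n}$, $B_2(x)=x^2-x+1/6$. $\mathcal{D}_N$ is the set of positive divisors of $N$ different from $N$. For $m\in\mathcal{D}_N$, $\ell(m)$ is the largest integer whose square divides $N/m$; $m''=N/(m\ell(m))$, $N'=N/\ell(m)$ (depending on $m$); $\mathcal{D}_N^*=\{m\in\mathcal{D}_N:\ell(m)>1\}$. For integers $g,h$ not both $0$ modulo $N$ let $$E_{g,h}(\tau)=q^{B_2(g/N)/2}\prod_{n=1}^\infty\left(1-\zeta_N^hq^{n-1+g/N}\right)\left(1-\zeta_N^{-h}q^{n-g/N}\right).$$ For each $m\in\mathcal{D}_N$ fix a set $S_{m''}\subset\{1,\dots,m''-1\}$ of representatives of $(\mathbf{Z}/m''\mathbf{Z})^\times/\{\pm1\}$; for $\alpha\in S_{m''}$ let $\delta\in\{1,\dots,m''-1\}$ with $\alpha\delta\equiv1\pmod{m''}$. Then $F_{m,h}(\tau)=\prod_{\alpha\in S_{m''}}E_{\alpha m\ell(m),\,\delta hN'}(N'\tau)$ if $m''\neq2$,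 and $F_{m,h}(\tau)=E_{m\ell(m),\,hN'}(N'\tau)^{1/2}$ if $m''=2$. *)

(* Defs.v *)
From HB Require Import structures.
From mathcomp Require Import all_boot all_order all_algebra.
From mathcomp Require Import all_classical all_reals all_analysis.
From mathcomp Require Import complex.

Set Implicit Arguments.
Unset Strict Implicit.
Unset Printing Implicit Defensive.

Import Order.TTheory GRing.Theory Num.Theory.
Import numFieldNormedType.Exports.

Local Open Scope complex_scope.
Local Open Scope classical_set_scope.
Local Open Scope ring_scope.

(* The complex numbers are R[i] over an arbitrary R : realType. The alias R[i]^o
   is convertible to R[i] and carries its usual topology. *)

Section Levels.
Local Open Scope nat_scope.

Definition DN (N : nat) : pred nat := [pred m | (m %| N) && (m != N)].

Definition max_sq (n : nat) : nat := \max_(l < n.+1 | l ^ 2 %| n) l.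

(* ell N m, mpp N m and Npr N m are l(m), m'' and N' at level N. *)
Definition ell (N m : nat) : nat := max_sq (N %/ m).

Definition mpp (N m : nat) : nat := N %/ (m * ell N m).

Definition Npr (N m : nat) : nat := N %/ ell N m.

Definition DNstar (N : nat) : pred nat :=
  [pred m | (m \in DN N) && (1 < ell N m)].

Definition eq_pm (k a b : nat) : bool := (a == b %[mod k]) || (k %| a + b).

(* A is a set of representatives in {1, ..., k - 1} of (Z/kZ)^* / {+-1}; uniq
   makes \prod_(a <- A) a product over this set. *)
Definition unit_reps (k : nat) (A : seq nat) : Prop :=
  [/\ uniq A,
      {in A, forall a, (0 < a < k) && coprime a k},
      forall a, coprime a k -> exists2 b, b \in A & eq_pm k a b
    & {in A &, forall a b, eq_pm k a b -> a = b}].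

(* The d in {1, ..., k - 1} with a * d = 1 mod k; when k > 1 it exists and is
   unique for every a coprime to k. *)
Definition inv_mod (k a : nat) : nat :=
  head 0 [seq d <- iota 1 k.-1 | a * d == 1 %[mod k]].

(* The truncated subtraction is the subtraction of integers: see eps_exact. *)
Definition eps (N m p : nat) : nat :=
  1 + logn p (ell N (m * p)) - logn p (ell N m).

Lemma max_sqP n : 0 < n ->
  (max_sq n ^ 2 %| n) /\ (forall d, d ^ 2 %| n -> d <= max_sq n).
Proof.
move=> n0.
have P1 : (inord 1 : 'I_n.+1) ^ 2 %| n by rewrite inordK // exp1n dvd1n.
split.
  rewrite /max_sq (bigop.bigmax_eq_arg (inord 1 : 'I_n.+1)) //.
  by case: arg_maxnP.
move=> d dn; have dle : d < n.+1.
  rewrite ltnS; apply: leq_trans (dvdn_leq n0 dn).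
  by case: d {dn} => // d; rewrite leq_pmulr.
exact: (@leq_bigmax_cond _ (fun l : 'I_n.+1 => l ^ 2 %| n)
          (fun l => nat_of_ord l) (Ordinal dle)).
Qed.

Lemma logn_max_sq p n d : prime p -> 0 < n -> d ^ 2 %| n ->
  logn p d <= logn p (max_sq n).
Proof.
move=> pp n0 dn; have [ln lmax] := max_sqP n0; set l := max_sq n in ln lmax *.
have l0 : 0 < l by case: posnP ln => // ->; rewrite dvd0n; case: (n) n0.
have : (l`_p^' * p ^ logn p d) ^ 2 %| n.
  rewrite expnMn Gauss_dvd; last first.
    rewrite coprimeXl // coprimeXr // coprimeXr // coprime_sym prime_coprime //.
    by have := part_pnat p^' l; rewrite -p'natE // => /pnatP; apply.
  apply/andP; split.
    by apply: dvdn_trans ln; apply: dvdn_exp2r; exact: dvdn_part.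
  by apply: dvdn_trans dn; apply: dvdn_exp2r; exact: pfactor_dvdnn.
move=> /lmax; rewrite -{2}(partnC p l0) mulnC leq_pmul2r ?part_gt0 //.
by rewrite p_part leq_exp2l // prime_gt1.
Qed.

Lemma eps_exact N m p : 0 < N -> m %| N -> prime p -> p %| ell N m ->
  eps N m p + logn p (ell N m) = 1 + logn p (ell N (m * p)).
Proof.
move=> N0 mN pp pl; rewrite /eps subnK // -leq_subLR.
have m0 := dvdn_gt0 N0 mN.
have n0 : 0 < N %/ m by rewrite divn_gt0 // dvdn_leq.
have [ln _] := max_sqP n0; rewrite -/(ell N m) in ln.
have -> : logn p (ell N m) - 1 = logn p (ell N m %/ p).
  by rewrite logn_div // (logn_prime p pp) eqxx.
have p0 := prime_gt0 pp.
have xn : (ell N m %/ p) ^ 2 * p %| N %/ m %/ p.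
  have pn : p %| N %/ m by apply: dvdn_trans ln; rewrite dvdn_exp.
  rewrite -(dvdn_pmul2r p0) divnK //; apply: dvdn_trans ln.
  by rewrite -{2}(divnK pl) expnMn -mulnA mulnn.
rewrite /ell divnMA; apply: logn_max_sq => //.
  rewrite divn_gt0 //; apply: dvdn_leq => //.
  by apply: dvdn_trans ln; rewrite dvdn_exp.
exact: dvdn_trans (dvdn_mulr _ (dvdnn _)) xn.
Qed.

End Levels.

Section ModularUnits.
Variable R : realType.
Local Notation C := R[i].

Definition cexp (z : C) : C :=
  (expR (complex.Re z))%:C * (cos (complex.Im z) +i* sin (complex.Im z)).

Definition upper_half : set C := [set tau | 0 < complex.Im tau].

(* q^x for q = e^{2 pi i tau} and a real exponent x *)
Definition qpow (tau : C) (x : R) : C := cexp (0 +i* (2 * pi * x) * tau).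

Definition zeta (n : nat) : C := cexp (0 +i* (2 * pi / n%:R)).

Definition B2 (x : R) : R := x ^+ 2 - x + 6^-1.

Definition E (N : nat) (g h : int) (tau : C) : C :=
  let x : R := g%:~R / N%:R in
  qpow tau (B2 x / 2) *
  lim ((fun n : nat => \prod_(1 <= k < n.+1)
          ((1 - zeta N ^ h * qpow tau (k%:R - 1 + x)) *
           (1 - zeta N ^ (- h) * qpow tau (k%:R - x))) : C^o) @ \oo).

(* g is a continuous branch of f^(1/2) on the upper half-plane; when f is
   holomorphic without zeros there are exactly two of them, g and -g, and they
   are holomorphic. *)
Definition is_sqrt_branch (f g : C -> C) : Prop :=
  (forall tau, upper_half tau -> {for tau, continuous (g : C^o -> C^o)}) /\
  (forall tau, upper_half tau -> g tau ^+ 2 = f tau).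

(* A choice of a branch of f^(1/2) for all the f that have one. *)
Definition sqrt_choice (sq : (C -> C) -> C -> C) : Prop :=
  forall f, (exists g, is_sqrt_branch f g) -> is_sqrt_branch f (sq f).

(* F_{m,h} for the representatives S k of (Z/kZ)^* / {+-1} and the choice sq of
   square roots. *)
Definition F (N : nat) (S : nat -> seq nat) (sq : (C -> C) -> C -> C)
    (m : nat) (h : int) (tau : C) : C :=
  let k := mpp N m in
  let l := ell N m in
  let N' := Npr N m in
  if k == 2%N then
    sq (fun t => E N (m * l)%:Z (h * N'%:Z) (N'%:R * t)) tau
  else
    \prod_(a <- S k)
      E N (a * m * l)%:Z ((inv_mod k a)%:Z * h * N'%:Z) (N'%:R * tau).

Definition eq_upto_const (f g : C -> C) : Prop :=
  exists2 c : C, c != 0 & forall tau, upper_half tau -> f tau = c * g tau.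

End ModularUnits.

(* Main.v *)
Require Import Defs.
From mathcomp Require Import all_boot all_order all_algebra.
From mathcomp Require Import all_classical all_reals all_analysis.
From mathcomp Require Import complex cyclic zify ring lra.

Set Implicit Arguments.
Unset Strict Implicit.
Unset Printing Implicit Defensive.

Import Order.TTheory GRing.Theory Num.Theory.
Import numFieldNormedType.Exports.
Import ComplexField.
Local Open Scope complex_scope.
Local Open Scope classical_set_scope.
Local Open Scope ring_scope.

(** Write siegel w x c tau for the product
      q^(c B2(x)/2) prod_(k >= 0) (1 - w q^(c(k+x))) (1 - w^-1 q^(c(k+1-x)))
    with w on the unit circle and 0 < x < 1.  At level m, with l = l(m), the
    function E_(a m l, d h N')(N' tau) is siegel w (a/m'') N' with
    w = zeta_N^(d h N'), a root of unity of order dividing l ([E_siegel],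
    [F_prod]).  Three exact identities hold, without any constant:
    - [siegel_root]: the product over j < p of siegel (w u^j) x c is
      siegel (w^p) x (p c), when u is a primitive p-th root of unity, because
      prod_j (1 - u^j z) = 1 - z^p;
    - [siegel_split]: siegel w x c is the product over i < p of
      siegel w ((x + i)/p) (p c), by sorting the factors according to k modulo
      p; the powers of q match by the distribution relation of B2;
    - [siegelN]: siegel w^-1 (1 - x) c = siegel w x c.

    Shifting h by (l/p) j multiplies w by the j-th power of a primitive p-th
    root of unity, since d is prime to p; so by the first identity the left-hand
    side is the product over a in S_(m'') of
    siegel (zeta_N^(d h p N')) (a/m'') (p N') ([prod_F_shift]).  For the
    right-hand side write N/m = l^2 s with s square-free ([ell_mulp]).
    - If p does not divide s, then l(mp) = l/p, m'' is unchanged, N' is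
      multiplied by p and eps = 0: the two sides agree factor by factor.
    - If p divides s, then l and N' are unchanged, m'' is divided by p and
      eps = 1.  Put M = m''/p.  The second identity turns the factor of b in S_M
      into the product of the factors of b + i M, i < p, and these numbers form
      another system of representatives modulo m'' = p M when M > 2
      ([unit_reps_blocks]).  By the third identity the product does not depend
      on the system ([unit_factor_pm], [unit_reps_map_perm]).

    A constant enters only when some m'' equals 2 and square roots are taken.
    There both sides are continuous on the upper half-plane and have equal
    squares without zeros, so they differ by a constant sign
    ([eq_upto_const_sqr]).  This uses that the infinite products are continuous
    and do not vanish ([continuous_inf_prod], [inf_prod_neq0]). *)

(** * The complex exponential and roots of unity *)

Section Exponential.
Variable R : realType.
Local Notation C := R[i].

Lemma complex_ext (z w : C) :
  complex.Re z = complex.Re w -> complex.Im z = complex.Im w -> z = w.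
Proof. by case: z w => [a b] [c d] /= -> ->. Qed.

Lemma cexpD (z w : C) : cexp (z + w) = cexp z * cexp w.
Proof.
case: z w => [a b] [c d]; rewrite /cexp /= expRD cosD sinD.
by apply: complex_ext => /=; ring.
Qed.

Lemma cexp0 : cexp (0 : C) = 1.
Proof. by rewrite /cexp /= expR0 cos0 sin0 mulr1. Qed.

Lemma cexp_neq0 (z : C) : cexp z != 0.
Proof.
apply/eqP => z0; have := cexpD z (- z).
by rewrite z0 mul0r subrr cexp0; apply/eqP; rewrite oner_eq0.
Qed.

Lemma normc_cexp (z : C) : Normc.normc (cexp z) = expR (complex.Re z).
Proof.
rewrite /cexp Normc.normcM /= expr0n /= addr0 sqrtr_sqr cos2Dsin2 sqrtr1 mulr1.
by rewrite ger0_norm // expR_ge0.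
Qed.

Lemma normr_normc (z : C) : `|z| = (Normc.normc z)%:C.
Proof. by rewrite normc_def; case: z. Qed.

Lemma qpowD (tau : C) x y : qpow tau (x + y) = qpow tau x * qpow tau y.
Proof.
rewrite /qpow -cexpD; congr cexp; case: tau => a b.
by apply: complex_ext => /=; ring.
Qed.

Lemma qpow0 (tau : C) : qpow tau 0 = 1.
Proof.
rewrite /qpow mulr0 -cexp0; congr cexp; case: tau => a b.
by apply: complex_ext => /=; ring.
Qed.

Lemma qpow_sum (tau : C) (I : Type) (r : seq I) (f : I -> R) :
  qpow tau (\sum_(i <- r) f i) = \prod_(i <- r) qpow tau (f i).
Proof.
elim: r => [|i r IH]; last by rewrite !big_cons qpowD IH.
by rewrite !big_nil qpow0.
Qed.

Lemma qpow_natM (tau : C) (n : nat) (x : R) :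
  qpow tau (n%:R * x) = qpow tau x ^+ n.
Proof.
elim: n => [|n IH]; first by rewrite mul0r qpow0 expr0.
by rewrite -natr1 mulrDl mul1r qpowD IH exprSr.
Qed.

Lemma qpow_neq0 (tau : C) x : qpow tau x != 0.
Proof. exact: cexp_neq0. Qed.

Lemma qpow_scale (tau : C) c x : qpow (c%:C * tau) x = qpow tau (c * x).
Proof.
rewrite /qpow; congr cexp; case: tau => a b.
by apply: complex_ext => /=; ring.
Qed.

Lemma normc_qpow (tau : C) x :
  Normc.normc (qpow tau x) = expR (- (2 * pi * x) * complex.Im tau).
Proof. by rewrite normc_cexp; case: tau => a b /=; congr expR; ring. Qed.

Lemma cexp_imX (x : R) (n : nat) :
  cexp (0 +i* x) ^+ n = cexp (0 +i* (x *+ n)) :> C.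
Proof.
elim: n => [|n IH]; first by rewrite expr0 mulr0n; exact/esym/cexp0.
rewrite exprS IH mulrS -cexpD; congr cexp.
by apply: complex_ext; rewrite /= ?addr0.
Qed.

Lemma zeta_neq0 n : zeta R n != 0.
Proof. exact: cexp_neq0. Qed.

Lemma normc_zeta n : Normc.normc (zeta R n) = 1.
Proof. by rewrite normc_cexp /= expR0. Qed.

Lemma zeta_prim n : (0 < n)%N -> n.-primitive_root (zeta R n).
Proof.
move=> n0; have n0R : (0 : R) < n%:R by rewrite ltr0n.
have zn : zeta R n ^+ n = 1.
  have -> : zeta R n ^+ n = cexp (0 +i* (pi *+ 2)).
    rewrite cexp_imX; congr (cexp (0 +i* _)).
    by rewrite -[LHS]mulr_natr -[RHS]mulr_natr; field; rewrite gt_eqF.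
  by rewrite /cexp /= expR0 cos2pi sin2pi mul1r.
have [k kP kn] := prim_order_exists n0 zn.
case: (ltngtP k n) (dvdn_leq n0 kn) => // [ltkn _|kEn _]; last first.
  by rewrite -{1}kEn.
(* For 0 < k < n, zeta ^ k = 1 would give cos (2 y) = 1 with 0 < y < pi. *)
have k0 := prim_order_gt0 kP.
have := prim_expr_order kP; rewrite cexp_imX /cexp /= expR0 mul1r => -[c1 _].
set y : R := pi * k%:R / n%:R.
have siny : 0 < sin y.
  apply: sin_gt0_pi; apply/andP; split.
    by rewrite divr_gt0 // mulr_gt0 ?pi_gt0 ?ltr0n.
  by rewrite ltr_pdivrMr // ltr_pM2l ?pi_gt0 // ltr_nat.
have y2 : 2 * pi / n%:R *+ k = y *+ 2 :> R.
  by rewrite /y -[LHS]mulr_natr -[RHS]mulr_natr; ring.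
move: c1; rewrite y2 cos_mulr2n cos2sin2 => c1.
have : sin y ^+ 2 = 0 by lra.
by move/eqP; rewrite sqrf_eq0 gt_eqF.
Qed.

Lemma zeta_exprz_mod n (i j : int) :
  (0 < n)%N -> (i = j %[mod n])%Z -> zeta R n ^ i = zeta R n ^ j.
Proof.
move=> n0 ij; have [k ->] : exists k, i = j + k * n%:Z.
  have : (n%:Z %| i - j)%Z by rewrite -eqz_mod_dvd; apply/eqP.
  by move/dvdzP => [k kE]; exists k; rewrite -kE addrC subrK.
rewrite expfzDr ?zeta_neq0 // mulrC [k * _]mulrC -exprz_exp -exprnP.
by rewrite (prim_expr_order (zeta_prim n0)) exp1rz mul1r.
Qed.

End Exponential.

(** * Limits and continuity in the complex plane *)

Section Topology.
Variable R : realType.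
Local Notation C := R[i].
Local Notation normc := (@Normc.normc R).

(** Neighbourhoods in R[i] are balls with radii in R[i]; all estimates below are
    made with real radii. *)
Lemma cvg_normc {T : Type} {F : set_system T} {FF : Filter F}
    (f : T -> C^o) (l : C) :
  f @ F --> (l : C^o) <->
  forall e : R, 0 < e -> \forall x \near F, normc (f x - l) < e.
Proof.
split=> [fl e e0|fl].
  have e0' : (0 : C) < e%:C by rewrite ltcR.
  have /cvgrPdistC_lt/(_ _ e0') := fl; apply: filterS => x.
  by rewrite normr_normc ltcR.
apply/cvgrPdistC_lt => e; rewrite ltcE /= => /andP[/eqP ei er].
have -> : e = (complex.Re e)%:C by apply: complex_ext; rewrite //= ei.
by apply: filterS (fl _ er) => x; rewrite normr_normc ltcR.
Qed.

Lemma near_normc (z : C) (e : R) :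
  0 < e -> \forall w \near (z : C^o), normc (w - z) < e.
Proof.
move=> e0; have [+ _] := @cvg_normc _ (nbhs (z : C^o)) _ (fun w => w) z.
by apply => //; exact: cvg_id.
Qed.

Lemma normc_distC (z w : C) : normc (z - w) = normc (w - z).
Proof. by rewrite -opprB normcN. Qed.

Lemma normc_ge0 (z : C) : 0 <= normc z.
Proof. by have := normr_ge0 z; rewrite normr_normc ler0c. Qed.

Lemma normc1X (w : C) n : normc w = 1 -> normc (w ^+ n) = 1.
Proof.
move=> w1; elim: n => [|n IH]; first by rewrite expr0 Normc.normc1.
by rewrite exprS Normc.normcM w1 IH mulr1.
Qed.

Lemma normc1V (w : C) : normc w = 1 -> normc w^-1 = 1.
Proof. by move=> w1; rewrite Normc.normcV w1 invr1. Qed.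

Lemma normc1Xz (w : C) (n : int) : normc w = 1 -> normc (w ^ n) = 1.
Proof. by move=> w1; case: n => n; [|apply: normc1V]; apply: normc1X. Qed.

Lemma normc_triangle (z w u : C) :
  normc (z - u) <= normc (z - w) + normc (w - u).
Proof. by apply: le_trans (le_normcD _ _); rewrite addrA subrK. Qed.

Lemma normc_Re_le (z : C) : `|complex.Re z| <= normc z.
Proof.
case: z => a b /=; rewrite -sqrtr_sqr ler_wsqrtr // lerDl sqr_ge0 //.
Qed.

Lemma normc_Im_le (z : C) : `|complex.Im z| <= normc z.
Proof.
case: z => a b /=; rewrite -sqrtr_sqr ler_wsqrtr // lerDr sqr_ge0 //.
Qed.

Lemma normc_le_ReIm (z : C) : normc z <= `|complex.Re z| + `|complex.Im z|.
Proof.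
case: z => a b; have -> : a +i* b = (a +i* 0) + (0 +i* b).
  by apply: complex_ext; rewrite /= ?addr0 ?add0r.
apply: le_trans (le_normcD _ _) _.
by rewrite /= !expr0n /= !addr0 !add0r !sqrtr_sqr.
Qed.

Lemma cvg_complex {T : Type} {F : set_system T} {FF : Filter F} (f g : T -> R)
    (a b : R) :
  f @ F --> a -> g @ F --> b ->
  (fun x => (f x +i* g x) : C^o) @ F --> (a +i* b : C^o).
Proof.
move=> fa gb; apply/cvg_normc => e e0.
have e2 : 0 < e / 2 by rewrite divr_gt0.
move/cvgrPdistC_lt/(_ _ e2): fa; move/cvgrPdistC_lt/(_ _ e2): gb.
apply: filterS2 => x gx fx.
by apply: le_lt_trans (normc_le_ReIm _) _ => /=; rewrite [e]splitr ltrD.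
Qed.

Lemma continuous_Re : continuous (fun z : C^o => complex.Re z : R).
Proof.
move=> z; apply/(@cvgrPdistC_lt R R _ _ (nbhs_filter (z : C^o))) => e e0.
apply: (@filterS _ _ (nbhs_filter (z : C^o)) _ _ _ (near_normc z e0)) => w.
apply: le_lt_trans; apply: le_trans (normc_Re_le _).
by case: w z => [a b] [c d].
Qed.

Lemma continuous_Im : continuous (fun z : C^o => complex.Im z : R).
Proof.
move=> z; apply/(@cvgrPdistC_lt R R _ _ (nbhs_filter (z : C^o))) => e e0.
apply: (@filterS _ _ (nbhs_filter (z : C^o)) _ _ _ (near_normc z e0)) => w.
apply: le_lt_trans; apply: le_trans (normc_Im_le _).
by case: w z => [a b] [c d].
Qed.

Lemma continuous_qpow x : continuous (fun tau : C^o => qpow tau x : C^o).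
Proof.
set k := 2 * pi * x.
have -> : (fun tau : C^o => qpow tau x : C^o) =
   (fun tau : C^o => (expR (- k * complex.Im tau) * cos (k * complex.Re tau) +i*
       (expR (- k * complex.Im tau) * sin (k * complex.Re tau)) : C^o)).
  apply: funext => -[a b]; rewrite /qpow /cexp -/k /=.
  have -> : 0 * a - k * b = - k * b by ring.
  have -> : 0 * b + k * a = k * a by ring.
  by apply: complex_ext => /=; ring.
move=> z; have FF := nbhs_filter (z : C^o).
have hI := @cvgMl_tmp _ _ _ FF _ (- k) _ (@continuous_Im z).
have hR := @cvgMl_tmp _ _ _ FF _ k _ (@continuous_Re z).
have hE := @cvg_comp _ _ _ _ _ _ _ _ hI (@continuous_expR R _).
have hC := @cvg_comp _ _ _ _ _ _ _ _ hR (@continuous_cos R _).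
have hS := @cvg_comp _ _ _ _ _ _ _ _ hR (@continuous_sin R _).
exact: (@cvg_complex _ _ FF _ _ _ _ (@cvgM _ _ _ FF _ _ _ _ hE hC)
  (@cvgM _ _ _ FF _ _ _ _ hE hS)).
Qed.

End Topology.

(** * Infinite products with geometrically small factors *)

Section InfiniteProducts.
Variable R : realType.
Local Notation C := R[i].
Local Notation normc := (@Normc.normc R).

Definition partial_prod (a : nat -> C) (n : nat) : C := \prod_(k < n) (1 + a k).

Definition inf_prod (a : nat -> C) : C :=
  lim ((partial_prod a : nat -> C^o) @ \oo).

Definition geom_bounded (M r : R) (a : nat -> C) :=
  forall k, normc (a k) <= M * r ^+ k.

Lemma partial_prodS a n : partial_prod a n.+1 = partial_prod a n * (1 + a n).
Proof. by rewrite /partial_prod big_ord_recr. Qed.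

Lemma limC_eq (u : nat -> C) (l : C) :
  (u : nat -> C^o) @ \oo --> (l : C^o) -> lim ((u : nat -> C^o) @ \oo) = l.
Proof. by move=> ul; apply: cvg_lim ul; exact: norm_hausdorff. Qed.

Section GeometricBound.
Variables (M r : R).
Hypotheses (M0 : 0 <= M) (r0 : 0 <= r) (r1 : r < 1).

Let B := expR (M / (1 - r)).
Let D := B * M / (1 - r).

Let r1' : 0 < 1 - r. Proof. by rewrite subr_gt0. Qed.

Let D0 : 0 <= D.
Proof. by rewrite /D divr_ge0 ?(ltW r1') // mulr_ge0 // expR_ge0. Qed.

(** Each |1 + a_k| is at most expR (M r^k), and the exponents sum to at most
    M / (1 - r). *)
Lemma partial_prod_le a n : geom_bounded M r a -> normc (partial_prod a n) <= B.
Proof.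
move=> ab.
have : normc (partial_prod a n) <= expR (M * (1 - r ^+ n) / (1 - r)).
  elim: n => [|n IH].
    rewrite /partial_prod big_ord0 Normc.normc1.
    by rewrite expr0 subrr mulr0 mul0r expR0.
  rewrite partial_prodS Normc.normcM.
  have -> : M * (1 - r ^+ n.+1) / (1 - r) =
      M * (1 - r ^+ n) / (1 - r) + M * r ^+ n.
    by rewrite exprS; field; rewrite gt_eqF.
  rewrite expRD ler_pM ?normc_ge0 //.
  apply: le_trans (le_normcD _ _) _; rewrite Normc.normc1.
  apply: le_trans (expR_ge1Dx _).
  by rewrite lerD2l ab.
move/le_trans; apply; rewrite ler_expR ler_pM2r ?invr_gt0 //.
by rewrite ler_piMr // lerBlDr lerDl exprn_ge0.
Qed.

(** The bound is telescoping: one more factor changes the product by at most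
    B M r^m = D (r^m - r^(m+1)). *)
Lemma partial_prod_dist a n d : geom_bounded M r a ->
  normc (partial_prod a (n + d) - partial_prod a n) <=
    D * (r ^+ n - r ^+ (n + d)).
Proof.
move=> ab; elim: d => [|d IH]; first by rewrite addn0 !subrr mulr0 Normc.normc0.
rewrite addnS; apply: le_trans (normc_triangle _ (partial_prod a (n + d)) _) _.
set m := (n + d)%N in IH *.
have -> : D * (r ^+ n - r ^+ m.+1) =
    D * (1 - r) * r ^+ m + D * (r ^+ n - r ^+ m).
  by rewrite exprS; ring.
apply: lerD => //.
rewrite partial_prodS mulrDr mulr1 addrAC subrr add0r Normc.normcM.
have -> : D * (1 - r) * r ^+ m = B * (M * r ^+ m).
  by rewrite /D divfK ?gt_eqF // mulrA.
by rewrite ler_pM ?normc_ge0 ?partial_prod_le.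
Qed.

Lemma cvg_expr0 (A : R) : A * r ^+ n @[n --> \oo] --> (0 : R).
Proof. by apply: cvg_geometric; rewrite ger0_norm. Qed.

(** Subtracting D r^n makes the sequence monotone, and it stays bounded. *)
Lemma real_geom_cvg (x : nat -> R) :
  (forall n d, `|x (n + d)%N - x n| <= D * (r ^+ n - r ^+ (n + d))) ->
  cvg (x @ \oo).
Proof.
move=> xD; pose y n := x n - D * r ^+ n.
have ynd : nondecreasing_seq y.
  apply/nondecreasing_seqP => n; rewrite /y.
  have := xD n 1%N; rewrite addn1 ler_norml => /andP[]; lra.
have yub : has_ubound (range y).
  exists (x 0%N + D) => _ [n _ <-]; rewrite /y.
  have := xD 0%N n; rewrite add0n ler_norml expr0 => /andP[_].
  have : 0 <= D * r ^+ n by rewrite mulr_ge0 // exprn_ge0.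
  lra.
have yc := nondecreasing_is_cvgn ynd yub.
have -> : x = y \+ (fun n => D * r ^+ n).
  by apply: funext => n; rewrite /y /= subrK.
by apply: is_cvgD => //; apply: cvgP (cvg_expr0 D).
Qed.

Lemma cvg_inf_prod a : geom_bounded M r a ->
  (partial_prod a : nat -> C^o) @ \oo --> (inf_prod a : C^o).
Proof.
move=> ab; set u := partial_prod a.
have Rec : cvg ((fun n => complex.Re (u n)) @ \oo).
  apply: real_geom_cvg => n d; apply: le_trans (partial_prod_dist n d ab).
  by apply: le_trans (normc_Re_le _); rewrite -/u; case: (u _) (u n) => ? ? [].
have Imc : cvg ((fun n => complex.Im (u n)) @ \oo).
  apply: real_geom_cvg => n d; apply: le_trans (partial_prod_dist n d ab).
  by apply: le_trans (normc_Im_le _); rewrite -/u; case: (u _) (u n) => ? ? [].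
have := cvg_complex Rec Imc.
have -> : (fun n => complex.Re (u n) +i* complex.Im (u n) : C^o) =
    (u : nat -> C^o).
  by apply: funext => n; case: (u n).
by move=> ul; rewrite /inf_prod -/u (limC_eq (ul _)); exact: ul.
Qed.

Lemma inf_prod_dist a n : geom_bounded M r a ->
  normc (inf_prod a - partial_prod a n) <= D * r ^+ n.
Proof.
move=> ab; apply/ler_addgt0Pl => e e0.
have /cvg_normc/(_ _ e0)[k _ kP] := cvg_inf_prod ab.
apply: le_trans (normc_triangle _ (partial_prod a (n + k)) _) _; apply: lerD.
  by rewrite normc_distC ltW // kP //= leq_addl.
apply: le_trans (partial_prod_dist n k ab) _.
by rewrite ler_wpM2l // lerBlDr lerDl exprn_ge0.
Qed.

(** The tails are bounded uniformly near z, so the limit inherits continuity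
    from the partial products. *)
Lemma continuous_inf_prod (a : nat -> C -> C) (z : C) :
  (forall k, {for z, continuous (a k : C^o -> C^o)}) ->
  (\forall w \near (z : C^o), geom_bounded M r (a^~ w)) ->
  {for z, continuous ((fun w => inf_prod (a^~ w)) : C^o -> C^o)}.
Proof.
move=> ac ab; have FF := nbhs_filter (z : C^o).
apply/(@cvg_normc _ _ _ FF) => e e0.
have e3 : 0 < e / 3 by rewrite divr_gt0.
have [k _ /(_ k (leqnn _)) /= kP] : \forall n \near \oo, D * r ^+ n < e / 3.
  by have /cvgrPdist_lt/(_ _ e3) := cvg_expr0 D;
    apply: filterS => n; rewrite sub0r normrN;
    apply: le_lt_trans; exact: ler_norm.
have pc : {for z, continuous ((fun w => partial_prod (a^~ w) k) : C^o -> C^o)}.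
  elim: k {kP} => [|n IH].
    have -> : (fun w : C^o => partial_prod (a^~ w) 0 : C^o) = (fun=> 1).
      by apply: funext => w; rewrite /partial_prod big_ord0.
    exact: cvg_cst.
  have -> : (fun w : C^o => partial_prod (a^~ w) n.+1 : C^o) =
     (fun w => partial_prod (a^~ w) n : C^o) \* (fun w => 1 + a n w : C^o).
    by apply: funext => w; rewrite partial_prodS.
  apply: (@cvgM C _ _ FF) IH _.
  exact: (@cvgD _ C^o _ _ FF _ _ _ _ (cvg_cst _) (ac n)).
have /cvg_normc/(_ _ e3) := pc.
have := nbhs_singleton ab.
move=> abz; move: ab; apply: filterS2 => w abw wz.
apply: le_lt_trans (normc_triangle _ (partial_prod (a^~ w) k) _) _.
rewrite [e](_ : _ = e / 3 + (e / 3 + e / 3)); last by field.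
apply: ltrD; first exact: le_lt_trans (inf_prod_dist _ _) kP.
apply: le_lt_trans (normc_triangle _ (partial_prod (a^~ z) k) _) _.
apply: ltrD => //; rewrite normc_distC.
exact: le_lt_trans (inf_prod_dist _ _) kP.
Qed.

End GeometricBound.

(** The factors 1 / (1 + a_k) = 1 + b_k also satisfy a geometric bound, so their
    product converges to an inverse of the limit.  The hypothesis M < 1 bounds
    all |1 + a_k| away from 0 at once. *)
Lemma inf_prod_neq0 (M r : R) (a : nat -> C) : 0 <= M < 1 -> 0 <= r < 1 ->
  geom_bounded M r a -> inf_prod a != 0.
Proof.
move=> /andP[M0 M1] /andP[r0 r1] ab.
have lb k : 1 - M <= normc (1 + a k).
  have := normc_triangle 1 (- a k) 0.
  rewrite opprK subr0 subr0 Normc.normc1 normcN.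
  have : M * r ^+ k <= M by rewrite ler_piMr // exprn_ile1 // ltW.
  have := ab k; lra.
have M1' : 0 < 1 - M by rewrite subr_gt0.
have nz k : 1 + a k != 0.
  apply/eqP => ak0; have := lb k; rewrite ak0 Normc.normc0; lra.
pose b k := - a k / (1 + a k).
have bb : geom_bounded (M / (1 - M)) r b.
  move=> k; rewrite /b Normc.normcM Normc.normcV normcN.
  rewrite mulrAC ler_pM ?normc_ge0 ?invr_ge0 ?normc_ge0 //.
  by rewrite lef_pV2 // posrE // (lt_le_trans M1').
have M'0 : 0 <= M / (1 - M) by rewrite divr_ge0 // ltW.
have ab1 n : partial_prod a n * partial_prod b n = 1.
  elim: n => [|n IH]; first by rewrite /partial_prod !big_ord0 mulr1.
  rewrite !partial_prodS mulrACA IH mul1r /b; field; exact: nz.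
have cab := @cvgM C _ _ _ _ _ _ _
  (cvg_inf_prod M0 r0 r1 ab) (cvg_inf_prod M'0 r0 r1 bb).
have c1 : (partial_prod a \* partial_prod b : nat -> C^o) @ \oo --> (1 : C^o).
  have -> : (partial_prod a \* partial_prod b : nat -> C^o) = (fun=> 1).
    by apply: funext => n; exact: ab1.
  exact: cvg_cst.
have ab1' : inf_prod a * inf_prod b = 1.
  by rewrite -(limC_eq (cab _)) (limC_eq c1).
apply/eqP => a0; move: ab1'; rewrite a0 mul0r => /eqP.
by rewrite eq_sym oner_eq0.
Qed.

End InfiniteProducts.

(** * Products of powers of q *)

Section QProducts.
Variable R : realType.
Local Notation C := R[i].
Local Notation normc := (@Normc.normc R).

Definition q_factor (w : C) (x c : R) (tau : C) (k : nat) : C :=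
  - (w * qpow tau (c * (k%:R + x))).

Definition q_prod (w : C) (x c : R) (tau : C) : C :=
  inf_prod (q_factor w x c tau).

(** Stated for a lower bound y of the imaginary part, because continuity at tau
    needs bounds valid in a neighbourhood of tau. *)
Lemma q_factor_bounded (w : C) (x c y : R) (tau : C) :
  normc w = 1 -> 0 < x -> 0 < c -> y <= complex.Im tau ->
  geom_bounded (expR (- (2 * pi * c * x * y))) (expR (- (2 * pi * c * y)))
    (q_factor w x c tau).
Proof.
move=> w1 x0 c0 ytau k; rewrite normcN Normc.normcM w1 mul1r normc_qpow.
rewrite -expRM_natl -expRD ler_expR mulNr.
have -> : - (2 * pi * c * x * y) + k%:R * - (2 * pi * c * y) =
  - (2 * pi * (c * (k%:R + x)) * y) by ring.
rewrite lerN2 ler_wpM2l // !mulr_ge0 ?pi_ge0 ?addr_ge0 //; exact: ltW.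
Qed.

Lemma expR_itv01 (c y : R) :
  0 < c -> 0 < y -> 0 <= expR (- (2 * pi * c * y)) < 1.
Proof.
move=> c0 y0; rewrite expR_ge0 -[ltRHS]expR0 ltr_expR oppr_lt0.
by rewrite !mulr_gt0 ?pi_gt0.
Qed.

Lemma cvg_q_prod (w : C) (x c : R) (tau : C) :
  normc w = 1 -> 0 < x -> 0 < c -> upper_half tau ->
  (partial_prod (q_factor w x c tau) : nat -> C^o) @ \oo -->
    (q_prod w x c tau : C^o).
Proof.
move=> w1 x0 c0 tauH; have /andP[r0 r1] := expR_itv01 c0 tauH.
apply: (cvg_inf_prod (expR_ge0 _) r0 r1).
exact: (q_factor_bounded w1 x0 c0 (lexx _)).
Qed.

Lemma q_prod_neq0 (w : C) (x c : R) (tau : C) :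
  normc w = 1 -> 0 < x -> 0 < c -> upper_half tau -> q_prod w x c tau != 0.
Proof.
move=> w1 x0 c0 tauH.
apply: (inf_prod_neq0 _ _ (q_factor_bounded w1 x0 c0 (lexx _))).
  by have := expR_itv01 (mulr_gt0 c0 x0) tauH; rewrite mulrA.
exact: expR_itv01 c0 tauH.
Qed.

Lemma continuous_q_prod (w : C) (x c : R) (tau : C) :
  normc w = 1 -> 0 < x -> 0 < c -> upper_half tau ->
  {for tau, continuous (q_prod w x c : C^o -> C^o)}.
Proof.
move=> w1 x0 c0 tauH; have y0 : 0 < complex.Im tau / 2 by rewrite divr_gt0.
have /andP[r0 r1] := expR_itv01 c0 y0.
apply: (continuous_inf_prod (expR_ge0 _) r0 r1).
  move=> k; have FF := nbhs_filter (tau : C^o).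
  apply: (@cvgN _ C^o _ _ FF).
  exact: (@cvgMl_tmp C _ _ FF _ w _ (@continuous_qpow R _ tau)).
have := near_normc (tau : C^o) y0; apply: filterS => z zt.
apply: (q_factor_bounded w1 x0 c0).
have := le_lt_trans (normc_Im_le _) zt; rewrite ltr_norml => /andP[+ _].
case: tau {tauH y0 r0 r1 zt} z => [a b] [a' b'] /=; lra.
Qed.

Lemma prod_root_factor (p : nat) (u z : C) : p.-primitive_root u ->
  \prod_(j < p) (1 - u ^+ j * z) = 1 - z ^+ p.
Proof.
move=> up; have p0 := prim_order_gt0 up.
have [->|z0] := eqVneq z 0.
  by rewrite expr0n gtn_eqF // subr0 big1 // => j _; rewrite mulr0 subr0.
have := congr1 (fun P : {poly C} => P.[z^-1]) (factor_Xn_sub_1 up).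
rewrite /= horner_prod big_mkord !hornerE => zE.
rewrite -[1 in RHS](@mulfV _ (z ^+ p)) ?expf_neq0 // -exprVn.
rewrite -[X in _ - X]mulr1 -mulrBr -zE -[p in z ^+ p]card_ord -prodr_const.
rewrite -big_split /=; apply: eq_bigr => j _.
by rewrite !hornerE mulrBr mulfV // mulrC.
Qed.

Lemma q_prod_root (p : nat) (u w : C) (x c : R) (tau : C) :
  p.-primitive_root u -> normc u = 1 -> normc w = 1 ->
  0 < x -> 0 < c -> upper_half tau ->
  \prod_(j < p) q_prod (w * u ^+ j) x c tau = q_prod (w ^+ p) x (p%:R * c) tau.
Proof.
move=> up u1 w1 x0 c0 tauH; have p0 := prim_order_gt0 up.
have uj j : normc (w * u ^+ j) = 1 by rewrite Normc.normcM w1 mul1r normc1X.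
have H : \prod_(j < p)
    (partial_prod (q_factor (w * u ^+ j) x c tau) n : C^o)
      @[n --> \oo] -->
    (\prod_(j < p) q_prod (w * u ^+ j) x c tau : C^o).
  apply: cvg_big; last by move=> j _; apply: cvg_q_prod.
  exact: mul_continuous.
rewrite -(limC_eq H) {H}.
apply: (congr1 (fun v : nat -> C^o => lim (v @ \oo))); apply: funext => n.
rewrite /partial_prod exchange_big /=; apply: eq_bigr => k _.
have -> : 1 + q_factor (w ^+ p) x (p%:R * c) tau k =
   1 - (w * qpow tau (c * (k%:R + x))) ^+ p.
  rewrite /q_factor exprMn -mulrA; congr (1 - _ * _).
  by rewrite qpow_natM.
rewrite -(prod_root_factor _ up); apply: eq_bigr => j _.
by rewrite /q_factor; congr (1 - _); ring.
Qed.

Lemma prod_ord_mul (p n : nat) (f : nat -> C) :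
  \prod_(k < p * n) f k = \prod_(i < p) \prod_(k < n) f (p * k + i)%N.
Proof.
elim: n => [|n IH].
  by rewrite muln0 big_ord0 big1 // => i _; rewrite big_ord0.
rewrite mulnSr big_split_ord /= IH -big_split /=; apply: eq_bigr => i _.
by rewrite big_ord_recr.
Qed.

Lemma q_prod_split (p : nat) (w : C) (x c : R) (tau : C) :
  (0 < p)%N -> normc w = 1 -> 0 < x -> 0 < c -> upper_half tau ->
  q_prod w x c tau = \prod_(i < p) q_prod w ((x + i%:R) / p%:R) (p%:R * c) tau.
Proof.
move=> p0 w1 x0 c0 tauH; have pR : (0 : R) < p%:R by rewrite ltr0n.
have H : \prod_(i < p)
    (partial_prod (q_factor w ((x + i%:R) / p%:R) (p%:R * c) tau) n : C^o)
      @[n --> \oo] -->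
    (\prod_(i < p) q_prod w ((x + i%:R) / p%:R) (p%:R * c) tau : C^o).
  apply: cvg_big; first exact: mul_continuous.
  move=> i _; apply: cvg_q_prod => //; last exact: mulr_gt0.
  by rewrite divr_gt0 // ltr_wpDr.
rewrite -(limC_eq H) {H}.
(* The partial products are compared along the multiples of p. *)
have Hc := @cvg_comp _ _ _ _ _ _ _ _ (@cvg_mulnl p p0)
  (cvg_q_prod w1 x0 c0 tauH).
rewrite -(limC_eq Hc) {Hc}.
apply: (congr1 (fun v : nat -> C^o => lim (v @ \oo))); apply: funext => n /=.
rewrite /partial_prod (prod_ord_mul p n (fun k => 1 + q_factor w x c tau k)).
apply: eq_bigr => i _; apply: eq_bigr => k _.
rewrite /q_factor; congr (1 - w * qpow tau _).
by rewrite natrD natrM; field; rewrite gt_eqF.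
Qed.

End QProducts.

(** * Siegel functions and their distribution relations *)

Section SiegelFunctions.
Variable R : realType.
Local Notation C := R[i].
Local Notation normc := (@Normc.normc R).

(** Up to the substitution of c tau for tau and an absolute constant this is the
    Siegel function with characteristic (x, arg w / 2 pi), with the real scale c
    kept as a parameter so that scales p c are available. *)
Definition siegel (w : C) (x c : R) (tau : C) : C :=
  qpow tau (c * (B2 x / 2)) * (q_prod w x c tau * q_prod w^-1 (1 - x) c tau).

Lemma E_siegel (N : nat) (g h : int) (c : R) (tau : C) :
  0 < (g%:~R / N%:R : R) < 1 -> 0 < c -> upper_half tau ->
  E N g h (c%:C * tau) = siegel (zeta R N ^ h) (g%:~R / N%:R) c tau.
Proof.
set x := g%:~R / N%:R => /andP[x0 x1] c0 tauH.
rewrite /E -/x /siegel qpow_scale; congr (_ * _).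
have w1 := normc1Xz h (normc_zeta R N).
have x1' : 0 < 1 - x by rewrite subr_gt0.
have H := @cvgM C _ _ _ _ _ _ _ (cvg_q_prod w1 x0 c0 tauH)
   (cvg_q_prod (normc1V w1) x1' c0 tauH).
rewrite -(limC_eq (H _)).
apply: (congr1 (fun v : nat -> C^o => lim (v @ \oo))); apply: funext => n /=.
rewrite big_add1 big_mkord big_split /=; congr (_ * _); apply: eq_bigr => k _.
  rewrite /q_factor qpow_scale; congr (1 - _ * qpow _ (c * _)).
  by rewrite -natr1 addrK.
rewrite /q_factor qpow_scale -invr_expz; congr (1 - _ * qpow _ (c * _)).
by rewrite -natr1 addrA.
Qed.

Lemma siegel_neq0 (w : C) (x c : R) (tau : C) :
  normc w = 1 -> 0 < x < 1 -> 0 < c -> upper_half tau -> siegel w x c tau != 0.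
Proof.
move=> w1 /andP[x0 x1] c0 tauH; have x1' : 0 < 1 - x by rewrite subr_gt0.
have w1' := normc1V w1.
by apply: mulf_neq0 (qpow_neq0 _ _) (mulf_neq0 _ _); apply: q_prod_neq0.
Qed.

Lemma continuous_siegel (w : C) (x c : R) (tau : C) :
  normc w = 1 -> 0 < x < 1 -> 0 < c -> upper_half tau ->
  {for tau, continuous (siegel w x c : C^o -> C^o)}.
Proof.
move=> w1 /andP[x0 x1] c0 tauH; have x1' : 0 < 1 - x by rewrite subr_gt0.
have FF := nbhs_filter (tau : C^o).
apply: (@cvgM C _ _ FF) (@continuous_qpow R _ tau) _.
exact: (@cvgM C _ _ FF _ _ _ _ (continuous_q_prod w1 x0 c0 tauH)
  (continuous_q_prod (normc1V w1) x1' c0 tauH)).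
Qed.

Lemma siegelN (w : C) (x c : R) (tau : C) :
  siegel w^-1 (1 - x) c tau = siegel w x c tau.
Proof.
rewrite /siegel invrK (_ : 1 - (1 - x) = x); last by ring.
rewrite (_ : B2 (1 - x) = B2 x); last by rewrite /B2; ring.
by rewrite [q_prod _ _ _ _ * _]mulrC.
Qed.

(** Both q-products are treated alike, since u^-1 is again a primitive p-th root
    of unity. *)
Lemma siegel_root (p : nat) (u w : C) (x c : R) (tau : C) :
  p.-primitive_root u -> normc u = 1 -> normc w = 1 ->
  0 < x < 1 -> 0 < c -> upper_half tau ->
  \prod_(j < p) siegel (w * u ^+ j) x c tau = siegel (w ^+ p) x (p%:R * c) tau.
Proof.
move=> up u1 w1 /andP[x0 x1] c0 tauH; have x1' : 0 < 1 - x by rewrite subr_gt0.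
have up' : p.-primitive_root u^-1.
  move: up; rewrite /primitive_root_of_unity => /andP[-> /forallP up].
  apply/forallP => i; rewrite unity_rootE exprVn invr_eq1 -unity_rootE.
  exact: up.
rewrite /siegel big_split /= [X in _ * X]big_split; congr (_ * (_ * _)).
- by rewrite prodr_const card_ord -(mulrA p%:R) qpow_natM.
- exact: q_prod_root.
- rewrite -exprVn -(q_prod_root up' (normc1V u1) (normc1V w1) x1' c0 tauH).
  by apply: eq_bigr => j _; rewrite invfM exprVn.
Qed.

(** The partial sum over i < n has a closed form, polynomial in n, which is
    proved by induction and then taken at n = p. *)
Lemma B2_distribution (p : nat) (x : R) : (0 < p)%N ->
  p%:R * \sum_(i < p) B2 ((x + i%:R) / p%:R) = B2 x.
Proof.
move=> p0; have pR : (p%:R : R) != 0 by rewrite pnatr_eq0 -lt0n.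
have -> : forall n : nat, \sum_(i < n) B2 ((x + i%:R) / p%:R) =
   n%:R * (x ^+ 2 / p%:R ^+ 2 - x / p%:R + 6^-1) +
   n%:R * (n%:R - 1) / 2 * (2 * x / p%:R ^+ 2 - p%:R^-1) +
   n%:R * (n%:R - 1) * (2 * n%:R - 1) / 6 / p%:R ^+ 2.
  elim=> [|n IH]; first by rewrite big_ord0; ring.
  by rewrite big_ord_recr /= IH /B2 -natr1; field.
by rewrite /B2; field.
Qed.

Lemma siegel_split (p : nat) (w : C) (x c : R) (tau : C) :
  (0 < p)%N -> normc w = 1 -> 0 < x < 1 -> 0 < c -> upper_half tau ->
  siegel w x c tau = \prod_(i < p) siegel w ((x + i%:R) / p%:R) (p%:R * c) tau.
Proof.
move=> p0 w1 /andP[x0 x1] c0 tauH; have x1' : 0 < 1 - x by rewrite subr_gt0.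
have pR : (p%:R : R) != 0 by rewrite pnatr_eq0 -lt0n.
rewrite /siegel [RHS]big_split /= [X in _ = _ * X]big_split.
congr (_ * (_ * _)).
- rewrite -qpow_sum; congr qpow; rewrite -(B2_distribution x p0).
  rewrite mulr_sumr mulr_suml mulr_sumr; apply: eq_bigr => i _; ring.
- exact: q_prod_split.
- rewrite (q_prod_split p0 (normc1V w1) x1' c0 tauH).
  (* 1 - (x + i) / p is ((1 - x) + (p - 1 - i)) / p. *)
  rewrite (reindex_inj rev_ord_inj) /=.
  apply: eq_bigr => i _ /=.
  have -> : (1 - x + (p - i.+1)%:R) / p%:R = 1 - (x + i%:R) / p%:R.
    rewrite natrB ?ltn_ord // -natr1; move: (i%:R) (p%:R : R) pR => a b b0.
    by field.
  by [].
Qed.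

(** At x = 1/2 and w = w^-1 the two q-products in siegel coincide, which gives
    an explicit continuous square root. *)
Definition sqrt_siegel (w : C) (c : R) (tau : C) : C :=
  qpow tau (c * (B2 2^-1 / 4)) * q_prod w 2^-1 c tau.

Lemma sqrt_siegel_branch (w : C) (c : R) :
  normc w = 1 -> w ^+ 2 = 1 -> 0 < c ->
  is_sqrt_branch (siegel w 2^-1 c) (sqrt_siegel w c).
Proof.
move=> w1 w2 c0; have h0 : 0 < 2^-1 :> R by rewrite invr_gt0.
split=> tau tauH.
  have FF := nbhs_filter (tau : C^o).
  exact: (@cvgM C _ _ FF _ _ _ _ (@continuous_qpow R _ tau)
    (continuous_q_prod w1 h0 c0 tauH)).
rewrite /sqrt_siegel /siegel.
have -> : w^-1 = w.
  have w0 : w != 0.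
    by apply: contra_eq_neq w2 => ->; rewrite expr0n /= eq_sym oner_eq0.
  by apply: (mulfI w0); rewrite mulfV // -expr2 w2.
have -> : 1 - 2^-1 = 2^-1 :> R by field.
rewrite exprMn.
rewrite [in RHS](_ : _ * (_ / 2) = c * (B2 2^-1 / 4) + c * (B2 2^-1 / 4)).
  by rewrite qpowD -!expr2.
by field.
Qed.

Lemma upper_half_segment (z w : C) (t : R) : upper_half z -> upper_half w ->
  0 <= t <= 1 -> upper_half (z + t%:C * (w - z)).
Proof.
case: z w => [a b] [a' b']; rewrite /upper_half /= => b0 b0' /andP[t0 t1].
have -> : b + (t * (b' - b) + 0 * (a' - a)) = (1 - t) * b + t * b' by ring.
have [->|tn1] := eqVneq t 1; first by rewrite subrr mul0r add0r mul1r.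
rewrite ltr_wpDr ?mulr_ge0 ?(ltW b0') // mulr_gt0 // subr_gt0 lt_neqAle tn1 //.
Qed.

Lemma continuous_segment (z w : C) (t : R) :
  {for t, continuous ((fun s : R => z + s%:C * (w - z)) : R -> C^o)}.
Proof.
case: z w => [a b] [a' b'].
have -> : (fun s : R => (a +i* b) + s%:C * ((a' +i* b') - (a +i* b)) : C^o) =
  (fun s : R => (a + (a' - a) * s) +i* (b + (b' - b) * s) : C^o).
  by apply: funext => s; apply: complex_ext => /=; ring.
apply: (@cvg_complex _ _ _ (nbhs_filter t)).
  apply: cvgD; [exact: cvg_cst|apply: cvgMl_tmp; exact: cvg_id].
apply: cvgD; [exact: cvg_cst|apply: cvgMl_tmp; exact: cvg_id].
Qed.

(** The quotient takes only the values 1 and -1.  If it took both, its real part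
    along the segment joining the two points would vanish somewhere by the
    intermediate value theorem. *)
Lemma eq_upto_const_sqr (f g : C -> C) :
  (forall tau, upper_half tau -> {for tau, continuous (f : C^o -> C^o)}) ->
  (forall tau, upper_half tau -> {for tau, continuous (g : C^o -> C^o)}) ->
  (forall tau, upper_half tau -> f tau ^+ 2 = g tau ^+ 2) ->
  (forall tau, upper_half tau -> g tau != 0) ->
  eq_upto_const f g.
Proof.
move=> fc gc fg g0.
pose phi tau := f tau / g tau.
have phi1 tau : upper_half tau -> (phi tau == 1) || (phi tau == -1).
  move=> tauH; rewrite -sqrf_eq1 /phi expr_div_n fg // divff //.
  by rewrite expf_neq0 // g0.
have phic tau : upper_half tau -> {for tau, continuous (phi : C^o -> C^o)}.
  move=> tauH; have FF := nbhs_filter (tau : C^o).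
  have gV := @cvgV C _ _ FF _ _ (g0 _ tauH) (gc _ tauH).
  exact: (@cvgM C _ _ FF _ _ _ _ (fc _ tauH) gV).
have iH : upper_half (0 +i* 1 : C) by rewrite /upper_half /= ltr01.
have phi_const tau : upper_half tau -> phi tau = phi (0 +i* 1).
  move=> tauH; pose gam (s : R) := (0 +i* 1) + s%:C * (tau - (0 +i* 1)).
  pose psi s := complex.Re (phi (gam s)).
  have gamH s : 0 <= s <= 1 -> upper_half (gam s).
    exact: upper_half_segment.
  have psi_neq0 s : 0 <= s <= 1 -> psi s != 0.
    move=> /gamH/phi1; rewrite /psi; move: (phi _) => z /orP[]/eqP ->.
      exact: oner_neq0.
    by rewrite /= oppr_eq0 oner_neq0.
  have psic : {within `[0, 1], continuous psi}.
    apply: continuous_in_subspaceT => s; rewrite inE /= in_itv /= => s01.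
    have c1 := @continuous_segment (0 +i* 1) tau s.
    have c2 := @cvg_comp _ _ _ _ _ _ _ _ c1 (phic _ (gamH _ s01)).
    exact: (@cvg_comp _ _ _ _ _ _ _ _ c2 (@continuous_Re R _)).
  have gam0 : gam 0 = 0 +i* 1 by rewrite /gam mul0r addr0.
  have gam1 : gam 1 = tau by rewrite /gam mul1r addrC subrK.
  have nsep : ~~ (Num.min (psi 0) (psi 1) <= 0 <= Num.max (psi 0) (psi 1)).
    apply/negP => sep; have [s] := IVT ler01 psic sep.
    by rewrite in_itv /= => /psi_neq0/eqP.
  move: nsep; rewrite /psi gam0 gam1.
  case/orP: (phi1 _ iH) => /eqP ->; case/orP: (phi1 _ tauH) => /eqP -> //=;
  by rewrite ge_min le_max lerN10 ler01 ?orbT.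
exists (phi (0 +i* 1)).
  by case/orP: (phi1 _ iH) => /eqP ->; rewrite ?oppr_eq0 oner_neq0.
by move=> tau tauH; rewrite -(phi_const _ tauH) /phi divfK // g0.
Qed.

End SiegelFunctions.

(** * Arithmetic of levels and of units up to sign *)

Section LevelArithmetic.
Local Open Scope nat_scope.

Definition square_free (s : nat) := forall e, e ^ 2 %| s -> e = 1.

Lemma max_sq_decomp n : 0 < n ->
  exists s, [/\ 0 < s, n = max_sq n ^ 2 * s & square_free s].
Proof.
move=> n0; have [ln lmax] := max_sqP n0.
have l0 : 0 < max_sq n by case: posnP ln => // ->; rewrite dvd0n; case: (n) n0.
exists (n %/ max_sq n ^ 2); have nE : n = max_sq n ^ 2 * (n %/ max_sq n ^ 2).
  by rewrite mulnC divnK.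
have s0 : 0 < n %/ max_sq n ^ 2 by rewrite divn_gt0 ?expn_gt0 ?l0 // dvdn_leq.
split=> // e es; have e0 : 0 < e by case: e es => //; rewrite dvd0n gtn_eqF.
have : (max_sq n * e) ^ 2 %| n by rewrite [X in _ %| X]nE expnMn dvdn_mul.
by move=> /lmax; rewrite -[leqRHS]muln1 leq_pmul2l //; case: e e0 {es} => [|[]].
Qed.

(** If e^2 divides d^2 s, dividing by the gcd of e and d leaves coprime numbers,
    so the square of e / gcd divides s and e divides d. *)
Lemma max_sq_mul d s :
  0 < d -> 0 < s -> square_free s -> max_sq (d ^ 2 * s) = d.
Proof.
move=> d0 s0 sf; have n0 : 0 < d ^ 2 * s by rewrite muln_gt0 expn_gt0 d0.
have [en emax] := max_sqP n0; set e := max_sq _ in en emax *.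
apply/eqP; rewrite eqn_leq; apply/andP; split; last first.
  by apply: emax; exact: dvdn_mulr.
set g := gcdn e d; have g0 : 0 < g by rewrite gcdn_gt0 d0 orbT.
have [ge gd] := (dvdn_gcdl e d, dvdn_gcdr e d).
suff : e %/ g = 1.
  by move=> eg; rewrite -(divnK ge) eg mul1n dvdn_leq.
apply: sf; have co : coprime (e %/ g) (d %/ g).
  rewrite /coprime -(eqn_pmul2r g0) mul1n muln_gcdl !divnK //.
rewrite -(@Gauss_dvdr _ ((d %/ g) ^ 2)) ?coprimeXl ?coprimeXr //.
have g20 : 0 < g ^ 2 by rewrite expn_gt0 g0.
rewrite -(@dvdn_pmul2r (g ^ 2)) // mulnAC -!expnMn !divnK //.
Qed.

Section Level.
Variables N m : nat.
Hypothesis (N0 : 0 < N) (mD : m \in DN N).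

Let mN : m %| N. Proof. by case/andP: mD. Qed.
Let m0 : 0 < m. Proof. exact: dvdn_gt0 N0 mN. Qed.
Let n0 : 0 < N %/ m. Proof. by rewrite divn_gt0 // dvdn_leq. Qed.

Lemma ell_gt0 : 0 < ell N m.
Proof.
have [] := max_sqP n0; rewrite -/(ell N m); case: posnP => // ->.
by rewrite dvd0n gtn_eqF.
Qed.

Lemma level_decomp : exists s, [/\ 0 < s, square_free s,
  N = m * (ell N m ^ 2 * s) & mpp N m = ell N m * s].
Proof.
have [s [s0 nE sf]] := max_sq_decomp n0; rewrite -/(ell N m) in nE.
have NE : N = m * (ell N m ^ 2 * s) by rewrite -nE mulnC divnK.
exists s; split=> //; rewrite /mpp {1}NE -mulnn -mulnA mulnA mulKn //.
by rewrite muln_gt0 m0 ell_gt0.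
Qed.

Lemma ell_dvd_mpp : ell N m %| mpp N m.
Proof. by have [s [_ _ _ ->]] := level_decomp; exact: dvdn_mulr. Qed.

Lemma mpp_mul : m * ell N m * mpp N m = N.
Proof.
by have [s [_ _ NE ->]] := level_decomp; rewrite [RHS]NE -mulnn; ring.
Qed.

Lemma Npr_mul : ell N m * Npr N m = N.
Proof.
by rewrite mulnC divnK // -[X in _ %| X]mpp_mul -mulnA dvdn_mull ?dvdn_mulr.
Qed.

Lemma Npr_gt0 : 0 < Npr N m.
Proof. by move: N0; rewrite -{1}Npr_mul muln_gt0 => /andP[]. Qed.

Lemma mpp_gt0 : 0 < mpp N m.
Proof. by move: N0; rewrite -{1}mpp_mul muln_gt0 => /andP[]. Qed.

Lemma mpp_gt1 : 1 < mpp N m.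
Proof.
have [s [s0 sf NE ->]] := level_decomp.
rewrite ltn_neqAle muln_gt0 ell_gt0 s0 eq_sym muln_eq1 /= andbT.
apply/negP => /andP[/eqP l1 /eqP s1].
case/andP: mD => _; rewrite {1}NE l1 s1 !muln1 eqxx //.
Qed.

Variable p : nat.
Hypotheses (pp : prime p) (pl : p %| ell N m).

Lemma mulp_DN : m * p \in DN N.
Proof.
have [s [s0 sf NE _]] := level_decomp; have p0 := prime_gt0 pp.
have l0 := ell_gt0.
have lE : ell N m = p * (ell N m %/ p) by rewrite mulnC divnK.
set x := ell N m %/ p in lE; have x0 : 0 < x by rewrite divn_gt0 // dvdn_leq.
have NE' : N = m * p * (p * (x ^ 2 * s)).
  rewrite [LHS]NE lE -!mulnn; ring.
rewrite inE {1}NE' dvdn_mulr //=; apply/eqP => mpE.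
have mp0 : 0 < m * p by rewrite muln_gt0 m0.
move: NE'; rewrite -mpE -[LHS]muln1 => /eqP; rewrite eqn_pmul2l // eq_sym.
by rewrite muln_eq1 gtn_eqF // prime_gt1.
Qed.

(** With N/m = l^2 s, N/(mp) is (l/p)^2 (p s), where p s is square-free if p
    does not divide s; otherwise it is l^2 (s/p). *)
Lemma ell_mulp :
  (ell N (m * p) = ell N m %/ p /\ mpp N (m * p) = mpp N m /\
     Npr N (m * p) = p * Npr N m /\ eps N m p = 0) \/
  (ell N (m * p) = ell N m /\ mpp N m = p * mpp N (m * p) /\
     Npr N (m * p) = Npr N m /\ eps N m p = 1).
Proof.
have [s [s0 sf NE mE]] := level_decomp; have p0 := prime_gt0 pp.
have l0 := ell_gt0.
have lE : ell N m = p * (ell N m %/ p) by rewrite mulnC divnK.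
set x := ell N m %/ p in lE *; have x0 : 0 < x by rewrite divn_gt0 // dvdn_leq.
have NmE : N %/ (m * p) = p * (x ^ 2 * s).
  rewrite {1}NE lE -!mulnn.
  have -> : m * (p * x * (p * x) * s) = m * p * (p * (x * x * s)) by ring.
  by rewrite mulKn // muln_gt0 m0.
have eE := eps_exact N0 mN pp pl.
have [ps|ps] := boolP (p %| s).
  right; have sE : s = p * (s %/ p) by rewrite mulnC divnK.
  set t := s %/ p in sE; have t0 : 0 < t by rewrite divn_gt0 // dvdn_leq.
  have tf : square_free t by move=> e et; apply: sf; rewrite sE dvdn_mull.
  have elE : ell N (m * p) = ell N m.
    rewrite /ell NmE -/(ell N m).
    rewrite (_ : p * (x ^ 2 * s) = ell N m ^ 2 * t) ?max_sq_mul //.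
    by rewrite lE sE -!mulnn; ring.
  have nz : 0 < m * p * ell N m by rewrite !muln_gt0 m0 p0.
  split=> //; split; last split.
  - rewrite mE /mpp elE {2}NE sE.
    rewrite (_ : m * _ = m * p * ell N m * (ell N m * t)) ?mulKn //; first ring.
    by rewrite -mulnn; ring.
  - by rewrite /Npr elE.
  - by move: eE; rewrite elE addnC [1 + _]addnC => /addnI.
left; have tf : square_free (p * s).
  move=> e eps; have [pe|pe] := boolP (p %| e).
    case/negP: ps; rewrite -(@dvdn_pmul2l p) //.
    by apply: dvdn_trans eps; rewrite mulnn dvdn_exp2r.
  apply: sf; move: eps; rewrite Gauss_dvdr // coprimeXl // coprime_sym.
  by rewrite prime_coprime.
have elE : ell N (m * p) = x.
  rewrite /ell NmE; have -> : p * (x ^ 2 * s) = x ^ 2 * (p * s) by ring.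
  by rewrite max_sq_mul // muln_gt0 p0.
split=> //; split; last split.
- by rewrite /mpp elE lE mulnA.
- have NE' : N = p * x * (m * (p * x) * s) by rewrite [LHS]NE lE -mulnn; ring.
  rewrite /Npr elE lE NE' mulKn ?muln_gt0 ?p0 //.
  by rewrite -!mulnA [p * (x * _)]mulnCA mulKn.
- have lx : logn p (ell N m) = 1 + logn p x.
    by rewrite lE lognM // logn_prime // eqxx.
  by move: eE; rewrite elE lx -[RHS]add0n => /addIn.
Qed.

End Level.

Section Units.

Lemma inv_modP k a : 1 < k -> coprime a k ->
  0 < inv_mod k a < k /\ a * inv_mod k a = 1 %[mod k].
Proof.
move=> k1 ak; rewrite /inv_mod; set s := seq.filter _ _.
have k0 : 0 < k by apply: ltnW.
have : has (fun d => a * d == 1 %[mod k]) (iota 1 k.-1).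
  have aE : a * (a ^ (totient k).-1 %% k) = 1 %[mod k].
    by rewrite modnMmr -expnS prednK ?totient_gt0 // Euler_exp_totient.
  apply/hasP; exists (a ^ (totient k).-1 %% k); last exact/eqP.
  rewrite mem_iota add1n prednK // ltn_pmod // andbT lt0n.
  by apply: contra_eq_neq aE => ->; rewrite muln0 mod0n modn_small.
rewrite has_filter -/s; case sE : s => [//|d s'] _ /=.
have : d \in s by rewrite sE mem_head.
rewrite mem_filter mem_iota => /andP[/eqP ? /andP[d0 dk]]; split=> //.
by rewrite d0 /=; lia.
Qed.

Lemma coprime_inv_mod k a : 1 < k -> coprime a k -> coprime (inv_mod k a) k.
Proof.
move=> k1 ak; have [/andP[d0 _] aV] := inv_modP k1 ak.
by apply: modn_coprime => //; exists a; rewrite mulnC aV modn_small.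
Qed.

Lemma inv_mod_unique k a d e :
  a * d = 1 %[mod k] -> a * e = 1 %[mod k] -> d = e %[mod k].
Proof.
move=> ad ae.
rewrite -[d]muln1 -modnMmr -ae modnMmr mulnCA mulnA.
by rewrite -modnMml ad modnMml mul1n.
Qed.

Lemma eq_pmC k a b : eq_pm k a b = eq_pm k b a.
Proof. by rewrite /eq_pm eq_sym addnC. Qed.

Lemma eq_pm_trans k b a c : eq_pm k a b -> eq_pm k b c -> eq_pm k a c.
Proof.
rewrite /eq_pm => /orP[/eqP ab|ab] /orP[/eqP bc|bc].
- by rewrite ab bc eqxx.
- by rewrite /dvdn -modnDml ab modnDml -/(dvdn _ _) bc orbT.
- by rewrite /dvdn -modnDmr -bc modnDmr -/(dvdn _ _) ab orbT.
- rewrite -(eqn_modDr b) [c + b]addnC.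
  by move: ab bc; rewrite /dvdn => /eqP -> /eqP ->; rewrite eqxx.
Qed.

Lemma eq_pm_dvd d k a b : d %| k -> eq_pm k a b -> eq_pm d a b.
Proof.
move=> dk /orP[/eqP ab|ab]; last by rewrite /eq_pm (dvdn_trans dk ab) orbT.
by rewrite /eq_pm -(modn_dvdm a dk) ab modn_dvdm // eqxx.
Qed.

(** Two systems of representatives are matched by sending each unit to the
    element of the other system equal to it up to sign. *)
Lemma unit_reps_map_perm k A B : unit_reps k A -> unit_reps k B ->
  exists2 phi, perm_eq (map phi A) B & {in A, forall a, eq_pm k a (phi a)}.
Proof.
move=> [Au Ain Asurj Ainj] [Bu Bin Bsurj Binj].
pose phi a := nth 0 B (find (eq_pm k a) B).
have phiP a : a \in A -> phi a \in B /\ eq_pm k a (phi a).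
  move=> /Ain/andP[_ /Bsurj[b bB ab]].
  have hasB : has (eq_pm k a) B by apply/hasP; exists b.
  by split; [rewrite mem_nth // -has_find|exact: nth_find].
exists phi => [|a /phiP[]//]; apply: uniq_perm => //.
  rewrite map_inj_in_uniq // => a a' aA a'A e; apply: Ainj => //.
  have [_ h] := phiP _ aA; have [_ h'] := phiP _ a'A.
  by apply: eq_pm_trans h _; rewrite e eq_pmC.
move=> b; apply/mapP/idP => [[a aA ->]|bB]; first by have [] := phiP _ aA.
have /andP[_ /Asurj[a aA ba]] := Bin _ bB; exists a => //.
have [paB apa] := phiP _ aA.
by apply: Binj => //; exact: eq_pm_trans ba apa.
Qed.

(** As p divides M, a number is prime to p M as soon as it is prime to M, so
    every lift of a unit modulo M is a unit.  For M = 2 the statement fails: 1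
    and 3 are equal up to sign modulo 4. *)
Lemma unit_reps_blocks p M A : prime p -> p %| M -> 2 < M -> unit_reps M A ->
  unit_reps (p * M) [seq b + i * M | b <- A, i <- iota 0 p].
Proof.
move=> pp pM M2 [Au Ain Asurj Ainj].
have p0 := prime_gt0 pp; have M0 : 0 < M by apply: ltn_trans M2.
have pM0 : 0 < p * M by rewrite muln_gt0 p0.
have pM1 : 1 < p * M by apply: (leq_trans (ltnW M2)); rewrite leq_pmull.
have co a : coprime a (p * M) = coprime a M.
  rewrite coprimeMr; apply/andb_idl => /coprime_dvdr; exact.
have blockP b i : b \in A -> (b + i * M) %% M = b.
  by move=> /Ain/andP[/andP[_ bM] _]; rewrite addnC modnMDl modn_small.
have mem_block a b : 0 < a < p * M -> b \in A -> a %% M = b ->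
    a \in [seq b + i * M | b <- A, i <- iota 0 p].
  move=> /andP[_ apM] bA ab; apply/allpairsP.
  exists (b, a %/ M) => /=; split=> //.
    by rewrite mem_iota /= add0n ltn_divLR.
  by rewrite addnC -ab -divn_eq.
have ltM b i : b \in A -> i \in iota 0 p -> b + i * M < p * M.
  move=> /Ain/andP[/andP[_ bM] _]; rewrite mem_iota /= add0n => ip.
  apply: (@leq_trans (i.+1 * M)); last by rewrite leq_mul2r ip orbT.
  by rewrite mulSn ltn_add2r.
split.
- apply: allpairs_uniq => //; first exact: iota_uniq.
  move=> [b i] [b' i'] /allpairsP[[? ?] /= [bA _ [-> ->]]].
  move=> /allpairsP[[? ?] /= [b'A _ [-> ->]]] /= e.
  have := congr1 (modn^~ M) e; rewrite !blockP // => bb; move: e; rewrite bb.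
  by move=> /addnI/eqP; rewrite eqn_pmul2r // => /eqP ->.
- move=> _ /allpairsP[[b i] /= [bA ip ->]].
  have /andP[/andP[b0 bM] bc] := Ain _ bA.
  by rewrite co -coprime_modl blockP // bc andbT addn_gt0 b0 ltM.
- move=> a; rewrite co => aM; have [b bA ab] := Asurj _ aM.
  have aM0 : 0 < a %% (p * M).
    rewrite lt0n; apply: contraTneq aM => a0.
    by rewrite -co /coprime -gcdn_modl a0 gcd0n gtn_eqF.
  case/orP: ab => [/eqP ab|ab].
    exists (a %% (p * M)); last by rewrite /eq_pm modn_mod eqxx.
    apply: (mem_block _ b) => //; first by rewrite aM0 ltn_pmod.
    have /andP[/andP[_ bM] _] := Ain _ bA.
    by rewrite modn_dvdm ?dvdn_mull // ab modn_small.
  exists (p * M - a %% (p * M)).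
    apply: (mem_block _ b) => //.
      by rewrite subn_gt0 ltn_pmod //= -[ltnRHS]subn0 ltn_sub2l.
    have /andP[/andP[_ bM] _] := Ain _ bA.
    rewrite -[RHS](modn_small bM); apply/eqP.
    rewrite -(eqn_modDr (a %% (p * M))) subnK ?(ltnW (ltn_pmod _ _)) // modnMl.
    by rewrite eq_sym -modnDmr modn_dvdm ?dvdn_mull // modnDmr addnC.
  rewrite /eq_pm /dvdn -[(a + _) %% _]modnDml subnKC ?(ltnW (ltn_pmod _ _)) //.
  by rewrite modnn eqxx orbT.
- move=> _ y /allpairsP[[b i] /= [bA ip ->]].
  move=> /allpairsP[[b' i'] /= [b'A ip' ->]] e.
  have bpm c k : eq_pm M c (c + k * M) by rewrite /eq_pm addnC modnMDl eqxx.
  have bb : b = b'.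
    apply: Ainj => //; apply: eq_pm_trans (bpm b i) _.
    apply: eq_pm_trans (eq_pm_dvd (dvdn_mull p (dvdnn M)) e) _.
    by rewrite eq_pmC bpm.
  move: e; rewrite -bb => /orP[/eqP|e].
    by rewrite !modn_small ?ltM.
  (* Otherwise b = - b modulo M with b a unit, which forces M to divide 2. *)
  have /andP[_ bc] := Ain _ bA.
  have : M %| b * 2.
    move: (dvdn_trans (dvdn_mull p (dvdnn M)) e).
    by rewrite addnACA -mulnDl addnn -muln2 dvdn_addl // dvdn_mull.
  rewrite Gauss_dvdr 1?coprime_sym // => /(dvdn_leq (ltn0Sn 1)).
  by rewrite leqNgt M2.
Qed.

End Units.
End LevelArithmetic.

(** * The functions F as products of Siegel functions *)

Section Distribution.
Variables (R : realType) (N : nat).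
Hypothesis N0 : (0 < N)%N.
Local Notation C := R[i].
Local Notation Z := (zeta R N).

Lemma zetaN_expz1 (i : int) : (N %| i)%Z -> Z ^ i = 1.
Proof.
move=> Ni; rewrite (@zeta_exprz_mod _ _ _ 0) ?expr0z //.
by apply/eqP; rewrite eqz_mod_dvd subr0.
Qed.

Lemma normc_zetaXz (i : int) : Normc.normc (Z ^ i) = 1.
Proof. by apply: normc1Xz; exact: normc_zeta. Qed.

Section Level.
Variables (m p : nat).
Hypotheses (mD : m \in DN N) (pp : prime p) (pl : (p %| ell N m)%N).
Let l := ell N m.
Let N' := Npr N m.
Let k := mpp N m.

Let N'R : (0 : R) < N'%:R. Proof. by rewrite ltr0n Npr_gt0. Qed.

(** The shift by (l/p) j multiplies zeta_N^(d h N') by the j-th power of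
    zeta_N^(d N/p), which is a primitive p-th root of unity. *)
Lemma prod_siegel_shift (d : nat) (h : int) (y : R) (tau : C) :
  coprime d p -> 0 < y < 1 -> upper_half tau ->
  \prod_(j < p)
    siegel (Z ^ (d%:Z * (h + ((l %/ p) * j)%N%:Z) * N'%:Z)) y N'%:R tau =
  siegel (Z ^ (d%:Z * h * (p * N')%N%:Z)) y (p * N')%:R tau.
Proof.
move=> dp y01 tauH; have p0 := prime_gt0 pp.
have pN : (p %| N)%N by rewrite -(Npr_mul N0 mD) dvdn_mulr.
have NE : (N %/ p = l %/ p * N')%N.
  have lE : l = (l %/ p * p)%N by rewrite divnK.
  by rewrite -{1}(Npr_mul N0 mD) -/l -/N' {1}lE mulnAC mulnK.
pose u := Z ^+ (N %/ p * d).
have up : p.-primitive_root u.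
  by rewrite /u exprM prim_root_exp_coprime // dvdn_prim_root // zeta_prim.
have w1 := normc_zetaXz (d%:Z * h * N'%:Z).
have := siegel_root up (normc1X _ (normc_zeta R N)) w1 y01 N'R tauH.
rewrite -natrM => uE.
have -> : Z ^ (d%:Z * h * (p * N')%N%:Z) = (Z ^ (d%:Z * h * N'%:Z)) ^+ p.
  by rewrite exprnP exprz_exp; congr (_ ^ _); rewrite PoszM; ring.
rewrite -uE; apply: eq_bigr => j _.
apply: (congr1 (fun z => siegel z y N'%:R tau)).
rewrite /u NE -exprM !exprnP -expfzDr ?zeta_neq0 //; congr (_ ^ _).
by rewrite !PoszM; ring.
Qed.

Variables (S : nat -> seq nat) (sq : (C -> C) -> C -> C).
Hypothesis S_reps : unit_reps k (S k).
Hypothesis sq_choice : sqrt_choice sq.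

Lemma F_prod (h : int) (tau : C) : k != 2%N -> upper_half tau ->
  F N S sq m h tau = \prod_(a <- S k)
    siegel (Z ^ ((inv_mod k a)%:Z * h * N'%:Z)) (a%:R / k%:R) N'%:R tau.
Proof.
move=> k2 tauH; rewrite /F (negPf k2); apply: eq_big_seq => a aS.
have [_ Sin _ _] := S_reps; have /andP[/andP[a0 ak] _] := Sin _ aS.
have k0 := mpp_gt0 N0 mD; have l0 := ell_gt0 N0 mD.
have m0 : (0 < m)%N by case/andP: mD => /dvdn_gt0 ->.
have aE : (a * m * l)%N%:Z%:~R / N%:R = a%:R / k%:R :> R.
  rewrite -pmulrn -{1}(mpp_mul N0 mD) -/l -/k !natrM.
  by field; rewrite !pnatr_eq0 -!lt0n m0 l0 k0.
rewrite -(rmorph_nat (real_complex R)) E_siegel -/l ?aE //.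
by rewrite divr_gt0 ?ltr0n // ltr_pdivrMr ?ltr0n // mul1r ltr_nat ak.
Qed.

(** Here l divides m'' = 2, so the root of unity is a sign and [sqrt_siegel]
    shows that a branch exists; sq therefore returns one. *)
Lemma F_sqrt (h : int) : k = 2%N ->
  is_sqrt_branch (siegel (Z ^ (h * N'%:Z)) 2^-1 N'%:R) (F N S sq m h).
Proof.
move=> k2; pose w := Z ^ (h * N'%:Z).
have w1 : Normc.normc w = 1 by exact: normc_zetaXz.
have w2 : w ^+ 2 = 1.
  rewrite exprnP exprz_exp zetaN_expz1 //.
  have := ell_dvd_mpp N0 mD; rewrite -/k k2 => /dvdnP[t tE].
  apply/dvdzP; exists (h * t%:Z); rewrite -[in RHS](Npr_mul N0 mD) -/l -/N'.
  by rewrite {1}tE -/l !PoszM; ring.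
have eqE t : upper_half t ->
    E N (m * l)%N%:Z (h * N'%:Z) (N'%:R * t) = siegel w 2^-1 N'%:R t.
  move=> tH; have l0 := ell_gt0 N0 mD.
  have m0 : (0 < m)%N by case/andP: mD => /dvdn_gt0 ->.
  have aE : (m * l)%N%:Z%:~R / N%:R = 2^-1 :> R.
    rewrite -pmulrn -{1}(mpp_mul N0 mD) -/l -/k k2 !natrM.
    by field; rewrite !pnatr_eq0 -!lt0n m0 l0.
  rewrite -(rmorph_nat (real_complex R)) E_siegel ?aE //.
  by apply/andP; split; lra.
have [] : is_sqrt_branch (fun t => E N (m * l)%N%:Z (h * N'%:Z) (N'%:R * t))
   (F N S sq m h).
  have [gc gE] := sqrt_siegel_branch w1 w2 N'R.
  have := sq_choice (f := fun t => E N (m * l)%N%:Z (h * N'%:Z) (N'%:R * t)).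
  rewrite /F -/k k2 /=; apply.
  exists (sqrt_siegel w N'%:R); split=> // t tH.
  by rewrite gE // eqE.
by move=> Fc FE; split=> // t tH; rewrite FE // eqE.
Qed.

(** The contribution of the unit a to the left-hand side of the relation. *)
Definition unit_factor (h : int) (tau : C) (a : nat) : C :=
  siegel (Z ^ ((inv_mod k a)%:Z * h * (p * N')%N%:Z))
    (a%:R / k%:R) (p * N')%:R tau.

Lemma prod_F_shift (h : int) (tau : C) : k != 2%N -> upper_half tau ->
  \prod_(j < p) F N S sq m (h + (l %/ p * j)%N%:Z) tau =
  \prod_(a <- S k) unit_factor h tau a.
Proof.
move=> k2 tauH.
rewrite (eq_bigr _
  (fun (j : 'I_p) _ => F_prod (h + (l %/ p * j)%N%:Z) k2 tauH)).
rewrite exchange_big /=; apply: eq_big_seq => a aS.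
have [_ Sin _ _] := S_reps; have /andP[/andP[a0 ak] ac] := Sin _ aS.
have k1 : (1 < k)%N by exact: leq_ltn_trans ak.
rewrite /unit_factor prod_siegel_shift //.
  apply: (coprime_dvdr (dvdn_trans pl (ell_dvd_mpp N0 mD))).
  exact: coprime_inv_mod.
have k0 := ltnW k1.
by rewrite divr_gt0 ?ltr0n // ltr_pdivrMr ?ltr0n // mul1r ltr_nat.
Qed.

(** This is why congruences modulo l between the inverses of units are enough:
    zeta_N^N' is a root of unity of order l. *)
Lemma zeta_expz_ell (d e : nat) (t : int) : d = e %[mod l] ->
  Z ^ (d%:Z * t * N'%:Z) = Z ^ (e%:Z * t * N'%:Z).
Proof.
move=> de; apply: zeta_exprz_mod => //; apply/eqP; rewrite eqz_mod_dvd.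
have : (l%:Z %| d%:Z - e%:Z)%Z by rewrite -eqz_mod_dvd !modz_nat de.
move/dvdzP => [q qE]; apply/dvdzP; exists (q * t).
rewrite -[in RHS](Npr_mul N0 mD) -/l -/N' PoszM.
have -> : q * t * (l%:Z * N'%:Z) = (q * l%:Z) * t * N'%:Z by ring.
by rewrite -qE; ring.
Qed.

(** Two distinct units below k that are equal up to sign add up to k; their
    inverses are then opposite modulo k, and [siegelN] applies. *)
Lemma unit_factor_pm (h : int) (tau : C) (a b : nat) :
  (0 < a < k)%N -> (0 < b < k)%N -> coprime a k -> coprime b k ->
  eq_pm k a b -> unit_factor h tau a = unit_factor h tau b.
Proof.
move=> /andP[a0 ak] /andP[b0 bk] ac bc /orP[|kab].
  by rewrite !modn_small // => /eqP ->.
have k1 : (1 < k)%N by exact: leq_ltn_trans ak.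
have kE : (a + b = k)%N.
  have /dvdnP[[|[|q]] qE] := kab; [lia|lia|].
  by move: qE; rewrite !mulSn; lia.
have [_ aV] := inv_modP k1 ac; have [_ bV] := inv_modP k1 bc.
set d := inv_mod k a in aV; set e := inv_mod k b in bV.
have de : (k %| d + e)%N.
  rewrite -(@Gauss_dvdr _ a) 1?coprime_sym // mulnDr.
  by rewrite /dvdn -modnDml aV -bV modnDml -mulnDl addnC kE modnMr.
rewrite /unit_factor -siegelN -/d -/e.
apply: (congr2 (fun z x => siegel z x (p * N')%:R tau)).
  rewrite invr_expz; apply: zeta_exprz_mod => //.
  apply/eqP; rewrite eqz_mod_dvd.
  have /dvdnP[q qE] := dvdn_trans (ell_dvd_mpp N0 mD) de.
  apply/dvdzP; exists (- (q%:Z * h * p%:Z)).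
  rewrite -[in RHS](Npr_mul N0 mD) -/l -/N' !PoszM.
  have -> : - (q%:Z * h * p%:Z) * (l%:Z * N'%:Z) =
      - ((q * l)%N%:Z * h * p%:Z * N'%:Z).
    by rewrite PoszM; ring.
  by rewrite -qE PoszD; ring.
by rewrite -kE natrD; field; rewrite -natrD pnatr_eq0 kE -lt0n ltnW.
Qed.

End Level.
End Distribution.

(** * The two cases of the relation *)

Section Cases.
Variables (R : realType) (N : nat).
Hypothesis N0 : (0 < N)%N.
Variable S : nat -> seq nat.
Hypothesis S_reps :
  forall m : nat, m \in DN N -> unit_reps (mpp N m) (S (mpp N m)).
Variable sq : (R[i] -> R[i]) -> R[i] -> R[i].
Hypothesis sq_choice : sqrt_choice sq.
Variables (m p : nat).
Hypotheses (mD : m \in DN N) (pp : prime p) (pl : (p %| ell N m)%N).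
Local Notation C := R[i].

Lemma sqrt_branches_eq (f f1 g g1 : C -> C) :
  is_sqrt_branch f f1 -> is_sqrt_branch g g1 ->
  (forall tau, upper_half tau -> f tau = g tau) ->
  (forall tau, upper_half tau -> g tau != 0) -> eq_upto_const f1 g1.
Proof.
move=> [fc fE] [gc gE] fg g0; apply: eq_upto_const_sqr => // tau tauH.
  by rewrite fE // gE // fg.
by rewrite -sqrf_eq0 gE // g0.
Qed.

Lemma is_sqrt_branch_prod (n : nat) (f f1 : 'I_n -> C -> C) :
  (forall j, is_sqrt_branch (f j) (f1 j)) ->
  is_sqrt_branch (fun tau => \prod_(j < n) f j tau)
    (fun tau => \prod_(j < n) f1 j tau).
Proof.
move=> ff1; split=> tau tauH.
  have FF := nbhs_filter (tau : C^o).
  apply: (@cvg_big C^o _ _ _ _ (@mul_continuous C) _ _ _ _ _ FF).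
  by move=> j _; have [+ _] := ff1 j; apply.
by rewrite -prodrXl; apply: eq_bigr => j _; have [_ ->] := ff1 j.
Qed.

(** For m'' = 2 both sides are square roots of the two sides of
    [prod_siegel_shift] with d = 1, the only unit modulo 2. *)
Lemma distribution_same_cofactor (h : int) :
  ell N (m * p) = (ell N m %/ p)%N -> mpp N (m * p) = mpp N m ->
  Npr N (m * p) = (p * Npr N m)%N ->
  eq_upto_const
    (fun tau : C =>
      \prod_(j < p) F N S sq m (h + (ell N m %/ p * j)%N%:Z) tau)
    (F N S sq (m * p)%N h).
Proof.
move=> elE mE NE; have mpD := mulp_DN N0 mD pp pl.
have N'R : (0 : R) < (p * Npr N m)%:R by rewrite ltr0n -NE Npr_gt0.
have [k2|k2] := eqVneq (mpp N m) 2%N.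
  have h01 : 0 < (2^-1 : R) < 1 by apply/andP; split; lra.
  have br j : is_sqrt_branch _ (F N S sq m (h + (ell N m %/ p * j)%N%:Z)) :=
    F_sqrt N0 mD S sq_choice _ k2.
  have brp := F_sqrt N0 mpD S sq_choice h (etrans mE k2).
  have brL := is_sqrt_branch_prod (fun j : 'I_p => br j).
  apply: (sqrt_branches_eq brL brp) => tau tauH.
    have := prod_siegel_shift N0 mD pp pl h (coprime1n p) h01 tauH.
    by rewrite mul1r NE => <-; apply: eq_bigr => j _; rewrite mul1r.
  by rewrite NE siegel_neq0 // normc_zetaXz.
exists 1; rewrite ?oner_eq0 // => tau tauH; rewrite mul1r.
rewrite (prod_F_shift N0 mD pp pl sq (S_reps mD)) //.
have k2' : mpp N (m * p) != 2%N by rewrite mE.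
by rewrite (F_prod N0 mpD sq (S_reps mpD) h k2' tauH) mE NE.
Qed.

Section Ramified.
Hypotheses (elE : ell N (m * p) = ell N m)
  (mE : mpp N m = (p * mpp N (m * p))%N)
  (NE : Npr N (m * p) = Npr N m).
Let M := mpp N (m * p).

(** An inverse of b + i M modulo p M is an inverse of b modulo M, hence both
    have the same residue modulo l, which divides M. *)
Lemma siegel_block (h : int) (b : nat) (tau : C) :
  (0 < b < M)%N -> coprime b M -> upper_half tau ->
  siegel (zeta R N ^ ((inv_mod M b)%:Z * (p%:Z * h) * (Npr N m)%:Z))
    (b%:R / M%:R) (Npr N m)%:R tau =
  \prod_(i < p) unit_factor N m p h tau (b + i * M)%N.
Proof.
move=> /andP[b0 bM] bc tauH.
have mpD := mulp_DN N0 mD pp pl; have p0 := prime_gt0 pp.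
have M1 : (1 < M)%N by apply: mpp_gt1 mpD.
have M0 : (0 < M)%N by exact: ltnW.
have lM : (ell N m %| M)%N by rewrite -elE ell_dvd_mpp.
have x01 : 0 < (b%:R / M%:R : R) < 1.
  by rewrite divr_gt0 ?ltr0n // ltr_pdivrMr ?ltr0n // mul1r ltr_nat.
have N'R : (0 : R) < (Npr N m)%:R by rewrite ltr0n Npr_gt0.
rewrite (siegel_split p0 (normc_zetaXz _ _ _) x01 N'R tauH).
apply: eq_bigr => i _; rewrite /unit_factor natrM.
have kE : mpp N m = (p * M)%N by [].
have k1 : (1 < mpp N m)%N by apply: mpp_gt1 mD.
have aM : coprime (b + i * M) M.
  by rewrite -coprime_modl addnC modnMDl coprime_modl.
have ac : coprime (b + i * M) (mpp N m).
  rewrite kE coprimeMr aM andbT; apply: coprime_dvdr aM.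
  exact: dvdn_trans lM.
have [_ dE] := inv_modP k1 ac; have [_ eE] := inv_modP M1 bc.
have de : inv_mod (mpp N m) (b + i * M) = inv_mod M b %[mod ell N m].
  rewrite -(modn_dvdm _ lM) -[in RHS](modn_dvdm _ lM); congr (_ %% _)%N.
  apply: (@inv_mod_unique M b) => //.
  have MK : (M %| mpp N m)%N by rewrite kE dvdn_mull.
  have := congr1 (modn^~ M) dE; rewrite !modn_dvdm // => <-.
  by rewrite -[in RHS]modnMml addnC modnMDl modnMml.
apply: (congr2 (fun z x => siegel z x _ tau)).
  have := zeta_expz_ell R N0 mD (p%:Z * h) de.
  rewrite -/M => <-; congr (_ ^ _); rewrite PoszM; ring.
rewrite kE natrD !natrM; field.
by rewrite !pnatr_eq0 -!lt0n p0 M0.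
Qed.

Lemma unit_reps4 : unit_reps 4 [:: 1%N].
Proof.
split=> // [a|a|a b]; rewrite ?inE.
- by move=> /eqP ->.
- rewrite -coprime_modl => a4; exists 1%N; rewrite ?inE //.
  rewrite /eq_pm /dvdn -[((a + 1) %% 4)%N]modnDml.
  by move: a4 (ltn_pmod a (isT : 0 < 4)%N); case: (a %% 4)%N => [|[|[|[|]]]].
- by move=> /eqP -> /eqP ->.
Qed.

Lemma distribution_ramified (h : int) :
  eq_upto_const
    (fun tau : C =>
      \prod_(j < p) F N S sq m (h + (ell N m %/ p * j)%N%:Z) tau)
    (F N S sq (m * p)%N (p%:Z * h)).
Proof.
have mpD := mulp_DN N0 mD pp pl; have p0 := prime_gt0 pp.
have M1 : (1 < M)%N by apply: mpp_gt1 mpD.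
have lM : (ell N m %| M)%N by rewrite -elE ell_dvd_mpp.
have pM : (p %| M)%N by exact: dvdn_trans lM.
have N'R : (0 : R) < (Npr N m)%:R by rewrite ltr0n Npr_gt0.
have pN'R : (0 : R) < (p * Npr N m)%:R by rewrite ltr0n muln_gt0 p0 Npr_gt0.
have k2 : mpp N m != 2%N.
  by rewrite mE -/M; have := prime_gt1 pp; move: M1; nia.
have prodE A : unit_reps (mpp N m) A -> forall tau, upper_half tau ->
    \prod_(j < p) F N S sq m (h + (ell N m %/ p * j)%N%:Z) tau =
    \prod_(a <- A) unit_factor N m p h tau a.
  move=> Areps tau tauH; rewrite (prod_F_shift N0 mD pp pl sq (S_reps mD)) //.
  have [phi phiA phiP] := unit_reps_map_perm (S_reps mD) Areps.
  rewrite -(perm_big _ phiA) big_map; apply: eq_big_seq => a aS.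
  have [_ Sin _ _] := S_reps mD; have [_ Ain _ _] := Areps.
  have /andP[a0 ac] := Sin _ aS.
  have phiaA : phi a \in A by rewrite -(perm_mem phiA) map_f.
  have /andP[b0 bc] := Ain _ phiaA.
  exact: unit_factor_pm (phiP _ aS).
(* For M = 2, p = 2 and m'' = 4: the block of 1 is {1, 3}, and its two
   elements contribute equal factors, so the left-hand side is a single factor
   whose square is the function under the square root on the right. *)
have [M2|M2] := eqVneq M 2%N.
  have p2 : p = 2%N.
    apply/eqP; rewrite eqn_leq prime_gt1 // andbT.
    by rewrite -M2 dvdn_leq // ltnW.
  have k4 : mpp N m = 4%N by rewrite mE -/M M2 p2.
  have [gc gE] := F_sqrt N0 mpD S sq_choice (p%:Z * h) M2.
  have G2 tau : upper_half tau -> unit_factor N m p h tau 1 ^+ 2 =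
      F N S sq (m * p)%N (p%:Z * h) tau ^+ 2.
    move=> tauH; rewrite gE // NE.
    have := @siegel_block h 1 tau; rewrite M2 => /(_ isT isT tauH).
    rewrite (_ : inv_mod 2 1 = 1%N) // !mul1r => ->.
    rewrite (eq_bigr (fun=> unit_factor N m p h tau 1)) => [|i _].
      by rewrite prodr_const card_ord p2.
    have i2 : (i < 2)%N by rewrite -p2.
    apply/esym/unit_factor_pm; rewrite ?k4 //;
    by case: (nat_of_ord i) i2 => [|[|]].
  have [c c0 cE] : eq_upto_const (fun tau => unit_factor N m p h tau 1)
      (F N S sq (m * p)%N (p%:Z * h)).
    have x01 : 0 < ((1%N)%:R / (mpp N m)%:R : R) < 1.
      by rewrite k4; apply/andP; split; lra.
    apply: (eq_upto_const_sqr _ gc G2) => tau tauH.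
      exact: continuous_siegel (normc_zetaXz _ _ _) x01 pN'R tauH.
    rewrite -sqrf_eq0 -G2 // sqrf_eq0.
    exact: siegel_neq0 (normc_zetaXz _ _ _) x01 pN'R tauH.
  exists c => // tau tauH; rewrite -cE // (prodE [:: 1%N]) ?big_seq1 // k4.
  exact: unit_reps4.
exists 1; rewrite ?oner_eq0 // => tau tauH; rewrite mul1r.
have Mgt2 : (2 < M)%N by rewrite ltn_neqAle eq_sym M2.
have Sreps := S_reps mpD; rewrite -/M in Sreps.
have Breps := unit_reps_blocks pp pM Mgt2 Sreps; rewrite -/M -mE in Breps.
rewrite (prodE _ Breps tau tauH).
rewrite (F_prod N0 mpD sq (S_reps mpD) _ M2 tauH) big_allpairs_dep.
apply: eq_big_seq => b bS.
have [_ Sin _ _] := Sreps; have /andP[b01 bc] := Sin _ bS.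
rewrite NE siegel_block // -{1}[p]subn0.
by rewrite -/(index_iota 0 p) big_mkord.
Qed.

End Ramified.
End Cases.

Theorem theorem1p15 (R : realType) (N : nat) (N_gt0 : (0 < N)%N)
  (S : nat -> seq nat)
  (S_reps : forall m : nat, m \in DN N -> unit_reps (mpp N m) (S (mpp N m)))
  (sq : (R[i] -> R[i]) -> R[i] -> R[i]) (sq_choice : sqrt_choice sq)
  (m : nat) (m_DNstar : m \in DNstar N)
  (p : nat) (p_prime : prime p) (p_dvd : (p %| ell N m)%N) (h : int) :
  let x : nat := (ell N m %/ p)%N in
  eq_upto_const
    (fun tau : R[i] => \prod_(j < p) F N S sq m (h + (x * j)%:Z) tau)
    (F N S sq (m * p)%N ((p ^ eps N m p)%:Z * h)).
Proof.
have mD : m \in DN N by case/andP: m_DNstar.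
have [[elE [mE [NE ->]]]|[elE [mE [NE ->]]]] := ell_mulp N_gt0 mD p_prime p_dvd.
  by rewrite expn0 mul1r; exact: distribution_same_cofactor.
by rewrite expn1; exact: distribution_ramified.
Qed.
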